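(* Let $T$ be a tree with $t\ge 2$ edges. Then for all sufficiently large $n$, $$\frac{n-1}{2(t-1)} \le f(n,T) \le \frac{2(n-1)}{t-1}.$$ Moreover, if $T$ is a star (with $t$ edges), then $$\frac{n-1}{t-1} \le f(n,T) \le \frac{n}{t-1}.$$
   Context: For positive integers $n,k$, an $(n,k)$-graph is a graph whose vertex set is a disjoint union of $n$ parts, each of size at most $k$, with no edges inside a part and exactly one edge between any two distinct parts. For a graph $H$, $f(n,H)=\min\{k\in\mathbb N : \text{there is an } (n,k)\text{-graph containing no subgraph isomorphic to } H\}$.
   Formalization: For stars the upper bound n/(t-1) is false as stated (t=4, n≡2 mod 3: no integer lies between the two bounds); it is proved rounded up for all large n, and unrounded whenever the interval [(n-1)/(t-1), n/(t-1)] contains an integer. *)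

(* Defs.v *)
From HB Require Import structures.
From mathcomp Require Import all_boot all_order all_algebra.
From mathcomp Require Import boolp.

Set Implicit Arguments.
Unset Strict Implicit.
Unset Printing Implicit Defensive.

Record sgraph := SGraph {
  vertex :> finType;
  edge : rel vertex;
  edge_sym : symmetric edge;
  edge_irrefl : irreflexive edge }.

Definition edge_set (G : sgraph) : {set {set G}} :=
  [set [set p.1; p.2] | p in [set p : G * G | edge p.1 p.2]].

Definition connected_graph (G : sgraph) : Prop :=
  0 < #|G| /\ forall x y : G, connect (@edge G) x y.

(* The bound 3 is needed because [ucycle] also accepts [::] and [:: x; y]
   for any edge xy. *)
Definition acyclic_graph (G : sgraph) : Prop :=
  ~ exists c : seq G, 3 <= size c /\ ucycle (@edge G) c.

Definition is_tree (G : sgraph) : Prop := connected_graph G /\ acyclic_graph G.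

Definition is_star (G : sgraph) : Prop :=
  exists c : G, forall x y : G,
    edge x y = (x != y) && ((x == c) || (y == c)).

(* G has a (not necessarily induced) subgraph isomorphic to H. *)
Definition contains_copy (H G : sgraph) : Prop :=
  exists h : H -> G, injective h /\ forall x y : H, edge x y -> edge (h x) (h y).

(* [part x] is the index of the part of x.  In the last clause an ordered pair
   (x, y) with x in part i and y in part j stands for the edge xy, so each edge
   between the parts i and j is counted once. *)
Definition nk_graph (n k : nat) (G : sgraph) : Prop :=
  [/\ 0 < n, 0 < k &
   exists part : G -> 'I_n,
   [/\ forall i : 'I_n, #|[set x | part x == i]| <= k,
       forall x y : G, part x = part y -> ~~ edge x y &
       forall i j : 'I_n, i != j ->
         #|[set p : G * G | [&& part p.1 == i, part p.2 == j & edge p.1 p.2]]|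
         = 1]].

Definition avoidable (n : nat) (H : sgraph) : pred nat :=
  fun k => `[< exists G : sgraph, nk_graph n k G /\ ~ contains_copy H G >].

(* The value 0 occurs only when the set is empty, as [nk_graph] requires
   0 < k. *)
Definition f_nk (n : nat) (H : sgraph) : nat :=
  if pselect (exists k, avoidable n H k) is left exk then ex_minn exk else 0.

Lemma f_nkP (n : nat) (H : sgraph) : (exists k, avoidable n H k) ->
  avoidable n H (f_nk n H) /\ forall k, avoidable n H k -> f_nk n H <= k.
Proof. by rewrite /f_nk; case: pselect => // exk _; case: ex_minnP. Qed.

(* Main.v *)
(** An (n,k)-graph has n(n-1)/2 edges on at most nk vertices.  A graph with more
    than (t-1)|V| edges has a subgraph of minimum degree at least t, into which
    a tree with t edges embeds greedily; a graph containing no star with t edges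
    has maximum degree at most t-1.  These give the lower bounds.

    For the upper bounds, choose for all parts v, w a label l(v,w) in
    {0, .., k-1} and join the vertex l(v,w) of part v to the vertex l(w,v) of
    part w: this is always an (n,k)-graph.  Labels that split, at each v, the
    n-1 other parts into classes of size at most t-1 bound the degrees by t-1.
    For a general tree, cut the parts into groups of size s = floor(t/2) and let
    l(v,w) name the group of w, the parts in the group of v sharing the label of
    some other group; every component then meets at most two groups, each part
    once, so it has at most 2s <= t vertices. *)

Require Import Defs.
From mathcomp Require Import all_boot all_order all_algebra.
From mathcomp Require Import boolp zify.
Import Order.TTheory GRing.Theory Num.Theory.

Set Implicit Arguments.
Unset Strict Implicit.
Unset Printing Implicit Defensive.

(** * Enumerating a tree by adding one leaf at a time *)

Definition nbhd (G : sgraph) (x : G) : {set G} := [set y | edge x y].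

Definition arcs_in (G : sgraph) (S : {set G}) : {set G * G} :=
  [set p | [&& p.1 \in S, p.2 \in S & edge p.1 p.2]].

(* Reading the sequence from its last element, each vertex has exactly one
   neighbour among the vertices met before it. *)
Fixpoint tree_seq (T : sgraph) (s : seq T) : Prop :=
  if s is y :: s' then
    [/\ y \notin s',
        s' = [::] \/ exists p, [/\ p \in s', edge y p &
                               forall q, q \in s' -> edge y q -> q = p]
      & tree_seq s']
  else True.

Definition connected_in (T : sgraph) (s : seq T) : Prop :=
  forall x y, x \in s -> y \in s ->
  exists p, [/\ path (@edge T) x p, last x p = y & {subset p <= s}].

Lemma path_exit (T : sgraph) (s : seq T) (x : T) (p : seq T) :
    x \in s -> path (@edge T) x p -> last x p \notin s ->
  exists a b, [/\ a \in s, b \notin s & edge a b].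
Proof.
elim: p x => [|y p IHp] x /= xs; first by rewrite xs.
case/andP=> exy yp lpNs; have [ys|yNs] := boolP (y \in s).
  exact: IHp yp lpNs.
by exists x, y.
Qed.

(** If [a] and [b] differed, a simple path between them inside [s] would close up through [y] to a
    cycle. *)
Lemma acyclic_unique_neighbour (T : sgraph) (s : seq T) (y a b : T) :
    acyclic_graph T -> connected_in s -> y \notin s -> a \in s -> b \in s ->
  edge y a -> edge y b -> a = b.
Proof.
move=> acT conn yNs as_ bs eya eyb; apply/eqP; case: eqP => // /eqP neq_ab.
case: acT; have [p [ap lp sub]] := conn _ _ as_ bs.
case/shortenP: ap lp => q aq uq sub_qp lq.
exists [:: y, a & q]; split.
  by case: q lq {aq uq sub_qp} => //= eab; rewrite eab eqxx in neq_ab.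
rewrite /ucycle /= rcons_path aq lq eya edge_sym eyb /=.
move: uq => /= ->; rewrite andbT inE negb_or; apply/andP; split.
  by apply: contraNneq yNs => ->.
by apply: contra yNs => /sub_qp/sub.
Qed.

(** While a vertex is missing, connectedness gives an edge leaving [s]; its outer end is added, and
    acyclicity makes its neighbour in [s] unique. *)
Lemma tree_seq_exists (T : sgraph) (k : nat) : is_tree T -> k < #|T| ->
  exists s : seq T, [/\ size s = k.+1, tree_seq s & connected_in s].
Proof.
case=> [[cardT connT] acT]; elim: k => [|k IHk] ltk.
  have [x _] := card_gt0P cardT; exists [:: x]; split=> //; first by split=> //; left.
  by move=> a b; rewrite !inE => /eqP-> /eqP->; exists [::].
have [s [szs ts conn]] := IHk (ltnW ltk).
have [z zNs] : exists z, z \notin s.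
  apply/existsP; apply: contraTT ltk; rewrite negb_exists => /forallP sT.
  rewrite -leqNgt -szs (leq_trans _ (card_size s)) //.
  by apply/subset_leq_card/subsetP => x _; have := sT x; rewrite negbK.
have [x xs] : exists x, x \in s.
  by case: s szs {ts conn zNs} => // x s _; exists x; rewrite mem_head.
have /connectP[p xp lp] := connT x z; rewrite {}lp in zNs.
have [a [b [as_ bNs eab]]] := path_exit xs xp zNs.
have eba : edge b a by rewrite edge_sym.
exists (b :: s); split; first by rewrite /= szs.
  split=> //; right; exists a; split=> // q qs ebq.
  exact: acyclic_unique_neighbour acT conn bNs qs as_ ebq eba.
have sub_s q : {subset q <= s} -> {subset q <= b :: s}.
  by move=> sub u /sub us; rewrite inE us orbT.
move=> u v; rewrite !inE => /orP[/eqP->|us] /orP[/eqP->|vs].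
- by exists [::].
- have [q [aq lq /sub_s sub]] := conn _ _ as_ vs; exists (a :: q); split=> //=.
    by rewrite eba.
  by move=> w; rewrite inE => /orP[/eqP->|/sub//]; rewrite inE as_ orbT.
- have [q [uq lq /sub_s sub]] := conn _ _ us as_; exists (rcons q b); split=> //.
  + by rewrite rcons_path uq lq.
  + by rewrite last_rcons.
  by move=> w; rewrite mem_rcons inE => /orP[/eqP->|/sub//]; rewrite mem_head.
- by have [q [uq lq /sub_s sub]] := conn _ _ us vs; exists q.
Qed.

(** Every vertex but the first one added brings exactly one new edge, the one to its unique earlier
    neighbour. *)
Lemma tree_seq_card_edges (T : sgraph) (s : seq T) : tree_seq s ->
  #|[set e in edge_set T | e \subset s]| = (size s).-1.
Proof.
elim: s => [_|y s IHs [yNs ys ts]] /=.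
  apply: eq_card0 => e; rewrite !inE; apply/negbTE/negP => /andP[].
  case/imsetP=> [[u v]] _ -> /subsetP/(_ u).
  by rewrite !inE eqxx => /(_ isT).
case: ys => [s0|[p [ps eyp uniq_p]]].
  rewrite s0; apply: eq_card0 => e; rewrite !inE; apply/negbTE/negP => /andP[].
  case/imsetP=> [[u v]]; rewrite inE /= => euv -> /subsetP sub.
  move: (sub u) (sub v); rewrite !inE !eqxx orbT => /(_ isT)/eqP uy /(_ isT)/eqP vy.
  by rewrite uy vy edge_irrefl in euv.
have -> : [set e in edge_set T | e \subset y :: s]
        = [set y; p] |: [set e in edge_set T | e \subset s].
  apply/setP => e; rewrite !inE; apply/andP/orP => [[]|].
    case/imsetP=> [[u v]]; rewrite inE /= => euv -> /subsetP sub.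
    have := sub u; have := sub v; rewrite !inE !eqxx orbT => /(_ isT) vs /(_ isT) us.
    case/orP: us => [/eqP uy|us]; last case/orP: vs => [/eqP vy|vs].
    - left; rewrite uy; rewrite uy in euv; case/orP: vs => [/eqP vy|vs].
        by rewrite vy edge_irrefl in euv.
      by rewrite (uniq_p v).
    - left; rewrite vy in euv *; rewrite edge_sym in euv.
      by rewrite (uniq_p u) // setUC.
    - right; apply/andP; split.
        by apply/imsetP; exists (u, v); rewrite ?inE.
      by apply/subsetP => w; rewrite !inE => /orP[]/eqP->.
  case=> [/eqP->|/andP[eT /subsetP es]].
    split; first by apply/imsetP; exists (y, p); rewrite ?inE.
    by apply/subsetP => w; rewrite !inE => /orP[]/eqP->; rewrite ?eqxx ?ps ?orbT.
  by split=> //; apply/subsetP => w /es ws; rewrite inE ws orbT.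
rewrite cardsU1 IHs // inE negb_and orbC.
have -> : ~~ ([set y; p] \subset s).
  by apply/negP => /subsetP/(_ y); rewrite !inE eqxx (negbTE yNs) => /(_ isT).
by case: s ps {yNs uniq_p IHs ts}.
Qed.

Lemma tree_enumeration (T : sgraph) : is_tree T ->
  exists s : seq T, [/\ size s = #|T|, tree_seq s & forall x, x \in s].
Proof.
move=> treeT; have cardT : 0 < #|T| by case: treeT => [[]].
have [|s [szs ts _]] := @tree_seq_exists T #|T|.-1 treeT; first by rewrite prednK.
rewrite prednK // in szs; exists s; split=> // x.
have us : uniq s by elim: s ts {szs} => //= y s IHs [-> _ /IHs].
have /card_uniqP cs := us.
have /subset_cardP eqs : #|s| = #|T| by rewrite cs.
by rewrite (eqs _ x) //; apply/subsetP.
Qed.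

Lemma tree_card (T : sgraph) : is_tree T -> #|T| = #|edge_set T|.+1.
Proof.
move=> treeT; have [s [szs ts sT]] := tree_enumeration treeT.
have cardT : 0 < #|T| by case: treeT => [[]].
rewrite -(prednK cardT) -szs -(tree_seq_card_edges ts); congr _.+1.
apply: eq_card => e; rewrite !inE; case: (_ \in edge_set T) => //=.
by apply/subsetP => x _.
Qed.

(** * Embedding trees into dense graphs *)

Lemma greedy_embedding (T G : sgraph) (W : {set G}) (t : nat) (s : seq T) :
    (forall x, x \in W -> t <= #|nbhd x :&: W|) -> W != set0 ->
    tree_seq s -> size s <= t.+1 ->
  exists h : T -> G, [/\ {in s &, injective h}, {in s, forall x, h x \in W} &
                         {in s &, forall x y, edge x y -> edge (h x) (h y)}].
Proof.
move=> degW /set0Pn[x0 x0W]; elim: s => [_ _|y s IHs [yNs ys ts] szs].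
  by exists (fun=> x0); split.
have [h [hinj hW hE]] := IHs ts (ltnW szs).
have [w [wW wNh wE]] : exists w, [/\ w \in W, w \notin [seq h x | x <- s] &
    {in s, forall q, edge y q -> edge w (h q)}].
  case: ys => [->|[p [ps eyp uniq_p]]]; first by exists x0; split.
  (* The vertex [h p] is not adjacent to itself, so only the images of the other [size s - 1 < t]
     vertices must be avoided among its neighbours. *)
  have [w] : exists w, w \in (nbhd (h p) :&: W) :\: [set x in [seq h x | x <- rem p s]].
    apply/set0Pn; rewrite -card_gt0 cardsD subn_gt0.
    apply: leq_ltn_trans (subset_leq_card (subsetIr _ _)) _.
    rewrite cardsE; apply: leq_ltn_trans (card_size _) _; rewrite size_map size_rem //.
    apply: leq_trans (degW _ (hW _ ps)).
    have : 0 < size s by case: s ps {hinj hW hE yNs ts IHs uniq_p szs}.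
    by move: szs => /=; lia.
  rewrite !inE => /andP[wNh /andP[ehw wW]]; exists w; split=> //.
    apply: contra wNh => /mapP[x xs wx]; apply/mapP; exists x => //.
    have [xp|neq_xp] := eqVneq x p; first by rewrite wx xp edge_irrefl in ehw.
    by have := perm_mem (perm_to_rem ps) x; rewrite xs inE (negbTE neq_xp) /= => <-.
  by move=> q qs eyq; rewrite (uniq_p q) // edge_sym.
have neq_y x : x \in s -> (x == y) = false.
  by move=> xs; apply: contraNF yNs => /eqP<-.
exists (fun x => if x == y then w else h x); split.
- move=> a b; rewrite !inE => /orP[/eqP->|as_] /orP[/eqP->|bs] //;
    rewrite ?eqxx ?neq_y //.
  + by move=> wE'; case/negP: wNh; apply/mapP; exists b.
  + by move=> wE'; case/negP: wNh; apply/mapP; exists a.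
  exact: hinj.
- by move=> a; rewrite inE => /orP[/eqP->|as_]; rewrite ?eqxx ?neq_y //; apply: hW.
- move=> a b; rewrite !inE => /orP[/eqP->|as_] /orP[/eqP->|bs];
    rewrite ?eqxx ?neq_y //.
  + by rewrite edge_irrefl.
  + exact: wE.
  + by rewrite edge_sym [in X in _ -> X]edge_sym; apply: wE.
  exact: hE.
Qed.

(** Arcs count each edge twice. Deleting a vertex of degree at most [t] loses at most [2 * t] arcs
    and so preserves the hypothesis; strictness keeps the set from becoming empty. *)
Lemma dense_subgraph (G : sgraph) (t : nat) (S : {set G}) :
    2 * t * #|S| < #|arcs_in S| ->
  exists2 W : {set G}, W != set0 & forall x, x \in W -> t < #|nbhd x :&: W|.
Proof.
have [m] := ubnP #|S|; elim: m S => // m IHm S ltSm dense.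
have [/forallP degS|/forallPn[x]] :=
    boolP [forall x, (x \in S) ==> (t < #|nbhd x :&: S|)].
  exists S => [|x]; last exact/implyP.
  apply: contraTneq dense => ->; rewrite cards0 muln0 -leqNgt leqn0 cards_eq0.
  by apply/eqP/setP => p; rewrite !inE.
rewrite negb_imply -leqNgt => /andP[xS degx].
have cardS := cardsD1 x S; rewrite xS in cardS.
apply: (IHm (S :\ x)); first lia.
have sub : arcs_in S \subset
    arcs_in (S :\ x) :|: (setX [set x] (nbhd x :&: S) :|: setX (nbhd x :&: S) [set x]).
  apply/subsetP => -[a b]; rewrite !inE /= => /and3P[-> -> eab]; rewrite !andbT.
  have [ax|_] := eqVneq a x; first by rewrite -ax eab.
  have [bx|_] /= := eqVneq b x; first by rewrite bx edge_sym in eab; rewrite eab ?orbT.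
  by rewrite eab.
have := subset_leq_card sub; rewrite !cardsU !cardsX !cards1; lia.
Qed.

(** * Counting in (n,k)-graphs and the lower bounds *)

Lemma nk_graph_card (n k : nat) (G : sgraph) : nk_graph n k G -> #|G| <= n * k.
Proof.
case=> _ _ [part [partk _ _]].
have -> : #|G| = \sum_(i < n) #|[set x | part x == i]|.
  rewrite -sum1_card (partition_big part predT) //=.
  by apply: eq_bigr => i _; rewrite -sum1_card; apply: eq_bigl => x; rewrite inE.
by rewrite -[n in n * k]card_ord -sum_nat_const; apply: leq_sum => i _.
Qed.

(** Group the arcs by the ordered pair of parts they join: a diagonal pair contributes none, any
    other exactly one. *)
Lemma nk_graph_card_arcs (n k : nat) (G : sgraph) : nk_graph n k G ->
  #|arcs_in [set: G]| = n * n.-1.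
Proof.
case=> _ _ [part [_ part0 part1]].
pose dpart (p : G * G) := (part p.1, part p.2).
rewrite -sum1_card (partition_big dpart predT) //=.
rewrite -(pair_bigA _ (fun i j => \sum_(p in arcs_in setT | dpart p == (i, j)) 1)) /=.
rewrite -[n in RHS]card_ord -sum_nat_const; apply: eq_bigr => i _.
rewrite (bigD1 i) //= big1 ?add0n => [|p]; last first.
  rewrite !inE /= => /andP[ep /eqP[p1 p2]].
  by have := part0 p.1 p.2; rewrite p1 p2 ep => /(_ erefl).
rewrite -(cardC1 i) -sum1_card; apply: eq_big => j; first by rewrite !inE.
move=> neq_ji; rewrite sum1dep_card -[RHS](part1 i j); last by rewrite eq_sym.
by apply: eq_card => p; rewrite !inE /= xpair_eqE andbC andbA.
Qed.

Lemma arcs_le_degree (G : sgraph) (d : nat) : (forall x : G, #|nbhd x| <= d) ->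
  #|arcs_in [set: G]| <= #|G| * d.
Proof.
move=> degG; rewrite -sum_nat_const -sum1_card.
rewrite (partition_big (fun p : G * G => p.1) predT) //=.
apply: leq_sum => x _; apply: leq_trans (degG x); rewrite sum1dep_card.
apply: leq_trans (leq_imset_card (pair x) (mem (nbhd x))).
apply/subset_leq_card/subsetP => -[a b]; rewrite !inE /= => /andP[eab /eqP ax].
by apply/imsetP; exists b; rewrite -?ax ?inE.
Qed.

Lemma nk_graph_avoids_tree (T G : sgraph) (n k t : nat) :
    is_tree T -> #|edge_set T| = t.+1 -> nk_graph n k G -> ~ contains_copy T G ->
  n.-1 <= 2 * t * k.
Proof.
move=> treeT edgesT nkG noT; have n_gt0 : 0 < n by case: nkG.
rewrite -(leq_pmul2l n_gt0) -(nk_graph_card_arcs nkG).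
have cardG : 2 * t * #|[set: G]| <= n * (2 * t * k).
  (* Were the bound to fail, the arcs would exceed [2 * t * #|G|], giving a subgraph of minimum
     degree at least [t.+1], the number of edges of [T]. *)
  by rewrite cardsT mulnCA leq_mul2l (nk_graph_card nkG) orbT.
apply: leq_trans cardG; rewrite leqNgt; apply/negP => /dense_subgraph[W W0 degW].
have [s [szs ts sT]] := tree_enumeration treeT.
have [|h [hinj _ hE]] := greedy_embedding degW W0 ts.
  by rewrite szs (tree_card treeT) edgesT.
by apply: noT; exists h; split=> [x y|x y]; [apply: hinj | apply: hE].
Qed.

(** The centre goes to [x] and the i-th leaf to the i-th neighbour of [x]. *)
Lemma star_embedding (T G : sgraph) (x : G) :
  is_star T -> #|T| <= #|nbhd x|.+1 -> contains_copy T G.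
Proof.
case=> c starT degx; pose L := enum [set~ c]; pose e := enum (nbhd x).
have szL : size L <= size e by rewrite -!cardE cardsC1; lia.
have memL z : z != c -> z \in L by move=> zc; rewrite mem_enum !inE.
have nthE z : z != c -> nth x e (index z L) \in nbhd x.
  by move=> /memL zL; rewrite -mem_enum mem_nth // (leq_trans _ szL) ?index_mem.
have nthNx z : z != c -> (x == nth x e (index z L)) = false.
  move=> /nthE; rewrite inE; apply: contraTF => /eqP<-.
  by rewrite edge_irrefl.
exists (fun z => if z == c then x else nth x e (index z L)); split=> [y z|y z].
  have [->|yc] := eqVneq y c; have [->|zc] // := eqVneq z c.
  - by move/eqP; rewrite nthNx.
  - by move/esym/eqP; rewrite nthNx.
  move/eqP; rewrite nth_uniq ?enum_uniq ?(leq_trans _ szL) ?index_mem ?memL //.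
  by move/eqP => eq_i; rewrite -(nth_index c (memL _ yc)) eq_i nth_index ?memL.
rewrite starT; have [->|yc] := eqVneq y c; have [zc|zc] //= := eqVneq z c.
- by move=> _; have := nthE _ zc; rewrite inE.
- by move=> _; have := nthE _ yc; rewrite inE edge_sym.
by rewrite andbF.
Qed.

Lemma nk_graph_avoids_star (T G : sgraph) (n k t : nat) :
    is_star T -> #|T| <= t.+2 -> nk_graph n k G -> ~ contains_copy T G ->
  n.-1 <= t * k.
Proof.
move=> starT cardT nkG noT; have n_gt0 : 0 < n by case: nkG.
rewrite -(leq_pmul2l n_gt0) -(nk_graph_card_arcs nkG).
have degG (x : G) : #|nbhd x| <= t.
  rewrite leqNgt; apply/negP => degx; apply: noT; apply: (@star_embedding _ _ x starT).
  by apply: leq_trans cardT _; rewrite ltnS.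
apply: leq_trans (arcs_le_degree degG) _.
by rewrite [t * k]mulnC mulnA leq_mul2r (nk_graph_card nkG) orbT.
Qed.

(** * Graphs given by labels *)

Section LabelGraph.

Variables (n k : nat) (l : 'I_n -> 'I_n -> 'I_k).

Definition label_rel : rel ('I_n * 'I_k) := fun p q =>
  [&& p.1 != q.1, p.2 == l p.1 q.1 & q.2 == l q.1 p.1].

Lemma label_rel_sym : symmetric label_rel.
Proof. by move=> p q; rewrite /label_rel eq_sym [X in _ && X]andbC. Qed.

Lemma label_rel_irrefl : irreflexive label_rel.
Proof. by move=> p; rewrite /label_rel eqxx. Qed.

Definition label_graph : sgraph := SGraph label_rel_sym label_rel_irrefl.

Lemma label_graph_nk : 0 < n -> 0 < k -> nk_graph n k label_graph.
Proof.
move=> n_gt0 k_gt0; split=> //; exists (fun p : 'I_n * 'I_k => p.1); split.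
- move=> i; rewrite -[k in X in _ <= X]card_ord.
  apply: leq_trans (leq_imset_card (pair i) 'I_k); apply/subset_leq_card/subsetP.
  by move=> [a b]; rewrite inE /= => /eqP->; apply: imset_f.
- by move=> x y xy; rewrite /edge /= /label_rel xy eqxx.
move=> i j neq_ij; rewrite -(cards1 ((i, l i j), (j, l j i))).
apply: eq_card => -[[a c] [b d]]; rewrite !inE /= /label_rel /= !xpair_eqE.
have [->|_] //= := eqVneq a i; have [->|_] /= := eqVneq b j; last by rewrite andbF.
by rewrite neq_ij.
Qed.

End LabelGraph.

(** * Constructions for the upper bounds *)

(** With the quotient constant on [A], the remainder of [f] modulo [d] is already injective
    there. *)
Lemma card_divn_eq (I : finType) (A : {set I}) (f : I -> nat) (d q : nat) :
    0 < d -> {in A &, injective f} -> (forall i, i \in A -> f i %/ d = q) ->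
  #|A| <= d.
Proof.
case: d => // d _ finj fq; rewrite -[d.+1 in X in _ <= X]card_ord.
rewrite -(@card_in_imset _ _ (fun i => inord (f i %% d.+1) : 'I_d.+1)) ?max_card //.
move=> i j iA jA /(congr1 val); rewrite /= !inordK ?ltn_mod // => eq_m.
by apply: finj => //; rewrite (divn_eq (f i) d.+1) (divn_eq (f j) d.+1) eq_m !fq.
Qed.

Lemma star_avoidable (T : sgraph) (n t : nat) :
    is_star T -> #|T| = t.+3 -> 1 < n ->
  avoidable n T (n.-2 %/ t.+1).+1.
Proof.
move=> [c starT] cardT n_gt1; apply/asboolP.
set k := n.-2 %/ t.+1.
(* [unbump v] numbers the parts other than [v] from 0 to [n - 2]; blocks of [t.+1] consecutive ones
   share a label, so degrees stay below the [t.+2] leaves of the star. *)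
pose l (v w : 'I_n) : 'I_k.+1 := inord (unbump v w %/ t.+1).
exists (label_graph l); split; first by apply: label_graph_nk => //; lia.
case=> h [hinj hE]; set v := (h c).1.
have edge_c z : z != c -> edge (h c) (h z).
  by move=> zc; apply: hE; rewrite starT eq_sym zc eqxx.
have : #|[set~ c]| <= t.+1.
  apply: (@card_divn_eq _ _ (fun z => unbump v (h z).1) t.+1 (h c).2) => //.
    move=> y z; rewrite !inE => /edge_c/and3P[yv hc2 y2] /edge_c/and3P[zv _ z2] eq_u.
    have eq1 : (h y).1 = (h z).1.
      apply/val_inj; have := unbumpKcond v (h y).1; rewrite eq_u unbumpKcond.
      rewrite -/v eq_sym -val_eqE in yv; rewrite -/v eq_sym -val_eqE in zv.
      by move: yv zv => /= /negbTE-> /negbTE->.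
    apply: hinj; rewrite [h y]surjective_pairing [h z]surjective_pairing eq1.
    by rewrite (eqP y2) (eqP z2) eq1.
  move=> z; rewrite !inE => /edge_c/and3P[zv /eqP-> _]; rewrite /l inordK //.
  rewrite ltnS leq_div2r //; have := ltn_ord (h z).1; have := ltn_ord v.
  rewrite -/v -val_eqE /= in zv; rewrite /unbump.
  by case: (ltngtP (val v) (val (h z).1)) zv => //= *; lia.
by rewrite cardsC1 cardT /=; lia.
Qed.

Lemma tree_avoidable (T : sgraph) (n s : nat) :
    is_tree T -> 2 * s < #|T| -> 0 < s < n ->
  avoidable n T (n.-1 %/ s).
Proof.
move=> [[_ connT] _] cardT /andP[s_gt0 lt_sn]; apply/asboolP.
have : 0 < n.-1 %/ s by rewrite divn_gt0 //; lia.
case Dk: (_ %/ s) => [//|k] _.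
(* [g v] is the group of part [v]; there are at most [k.+2] groups. *)
pose g (v : 'I_n) : 'I_k.+2 := inord (v %/ s).
have gE v : g v = v %/ s :> nat.
  by rewrite inordK // ltnS -Dk leq_div2r //; have := ltn_ord v; lia.
(* [unlift] names the group of [w] among the groups other than that of [v], which saves one label;
   inside a group the default [ord0] is used. *)
pose l (v w : 'I_n) : 'I_k.+1 := odflt ord0 (unlift (g v) (g w)).
exists (label_graph l); split; first by apply: label_graph_nk => //; lia.
(* The two groups that a vertex serves: its own and the one its label names. Edges preserve this
   pair, so a connected copy of [T] has a single piece. *)
pose piece (p : label_graph l) := [set g p.1; lift (g p.1) p.2].
have piece_edge p q : edge p q -> piece p = piece q.
  case/and3P=> _ /eqP p2 /eqP q2; rewrite /piece p2 q2 /l.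
  case: unliftP => [j ->|eq_g]; case: unliftP => [i Ei|//] /=.
  - by rewrite -Ei setUC.
  - by move/eqP; rewrite (negbTE (neq_lift _ _)).
  - by move/eqP: Ei; rewrite eq_g (negbTE (neq_lift _ _)).
  - by rewrite eq_g.
case=> h [hinj hE]; have /card_gt0P[x0 _] : 0 < #|T| by apply: leq_trans cardT.
have piece_h x : piece (h x) = piece (h x0).
  have /connectP[p x0p ->] := connT x0 x; elim: p x0 x0p => //= y p IHp x1.
  by case/andP=> /hE/piece_edge-> /IHp.
(* Within one piece, the part of a vertex fixes its own group, hence the other group, hence its
   label. *)
have fst_inj : injective (fun x => (h x).1).
  move=> x y eq1; apply: hinj; have := piece_h y; rewrite -(piece_h x) /piece -eq1.
  move/setP/(_ (lift (g (h x).1) (h x).2)); rewrite !inE eqxx orbT.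
  rewrite eq_sym (negbTE (neq_lift _ _)) (inj_eq lift_inj) => /eqP eq2.
  by rewrite [h x]surjective_pairing [h y]surjective_pairing eq1 eq2.
have fiber i : #|[set x | g (h x).1 == i]| <= s.
  apply: (@card_divn_eq _ _ (fun x => (h x).1 : nat) s i) => //.
    by move=> x y _ _ /val_inj/fst_inj.
  by move=> x; rewrite inE -gE => /eqP->.
move: cardT; rewrite ltnNge => /negP[].
set i := g (h x0).1; set j := lift i (h x0).2.
rewrite mul2n -addnn; apply: leq_trans (leq_add (fiber i) (fiber j)).
rewrite -cardsT; apply: leq_trans (leq_card_setU _ _).
apply/subset_leq_card/subsetP => x _; have : g (h x).1 \in piece (h x0).
  by rewrite -(piece_h x) !inE eqxx.
by rewrite !inE.
Qed.

(** * The bounds on f(n,T) *)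

Lemma f_nk_le (n : nat) (H : sgraph) (k : nat) : avoidable n H k -> f_nk n H <= k.
Proof. by move=> avk; have [_] := f_nkP (ex_intro _ k avk); apply. Qed.

Local Open Scope ring_scope.

(* In the star case f_nk n T is an integer, and the interval
   [(n - 1) / (t - 1), n / (t - 1)] contains no integer when t - 1 divides
   neither n - 1 nor n; the upper bound n / (t - 1) is therefore rounded up in
   general, and kept unrounded whenever that interval contains an integer. *)
Theorem theorem1p5 (T : sgraph) (t : nat)
    (treeT : is_tree T) (edgesT : #|edge_set T| = t) (t_ge2 : (2 <= t)%N) :
  exists N : nat, forall n : nat, (N <= n)%N ->
    ((n%:R - 1) / (2 * (t%:R - 1)) <= (f_nk n T)%:R :> rat /\
     (f_nk n T)%:R <= 2 * (n%:R - 1) / (t%:R - 1) :> rat) /\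
    (is_star T ->
     [/\ (n%:R - 1) / (t%:R - 1) <= (f_nk n T)%:R :> rat,
         (f_nk n T)%:R <= Num.ceil (n%:R / (t%:R - 1) : rat) :> int &
         (exists m : nat,
            (n%:R - 1) / (t%:R - 1) <= m%:R :> rat /\
            m%:R <= n%:R / (t%:R - 1) :> rat) ->
         (f_nk n T)%:R <= n%:R / (t%:R - 1) :> rat]).
Proof.
case: t edgesT t_ge2 => [|[|t]] // edgesT _.
exists t.+2 => n le_tn; have cardT := tree_card treeT; rewrite edgesT in cardT.
have predE (m : nat) : (m.+1%:R - 1 : rat) = m%:R by rewrite -addn1 natrD addrK.
have dT : (0 : rat) < t.+1%:R by rewrite ltr0n.
(* From here on [n.+1] is the number of parts and [t.+2] the number of edges of [T]. *)
case: n le_tn => [//|n] le_tn; rewrite !predE.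
have av : avoidable n.+1 T (n %/ t.+2./2)%N.
  by apply: (@tree_avoidable T n.+1) => //; rewrite ?cardT; lia.
(* By [av] the minimum is genuine rather than the default 0, so some [G] attains it and the lower
   bounds apply to [G]. *)
have [|/asboolP[G [nkG noT]] _] := @f_nkP n.+1 T.
  by exists (n %/ t.+2./2)%N.
have le_f := f_nk_le av.
split; first split.
- rewrite ler_pdivrMr ?mulr_gt0 // -natrM -natrM ler_nat.
  by have := nk_graph_avoids_tree treeT edgesT nkG noT; rewrite /=; lia.
(* The group size [t.+2./2] is at least half of [t.+1]. *)
- rewrite ler_pdivlMr // -!natrM ler_nat; have := leq_divM n t.+2./2.
  by nia.
move=> starT.
have lower : (n <= t.+1 * f_nk n.+1 T)%N.
  by apply: (nk_graph_avoids_star starT _ nkG noT); rewrite cardT.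
(* As [n] is positive, the right-hand side is [n / t.+1] rounded up. *)
have le_fs : (f_nk n.+1 T <= (n.-1 %/ t.+1).+1)%N.
  by apply/f_nk_le/star_avoidable => //; lia.
split.
- by rewrite ler_pdivrMr // -natrM ler_nat mulnC.
- apply: (@le_trans _ _ ((n.-1 %/ t.+1)%N%:Z + 1)).
    by rewrite natz -PoszD addn1.
  rewrite lezD1 ceil_gt_int -pmulrn ltr_pdivlMr // -natrM ltr_nat.
  by apply: leq_ltn_trans (leq_divM _ _) _; lia.
(* An integer [m] that is at least [n / t.+1] is at least its ceiling, hence at least [f_nk n.+1 T]
   by [le_fs]. *)
case=> m []; rewrite ler_pdivrMr // -natrM ler_nat => le_nm; apply: le_trans.
rewrite ler_nat; apply: leq_trans le_fs _; rewrite ltn_divLR //; lia.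
Qed.
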